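(* Let $f=\sum_{n=1}^\infty \frac{1}{2n+1}\binom{3n}{n}x^n$. Write $F(a,b;c)$ for ${}_2F_1\left(a,b;c\mid \frac{27}{4}x\right)$. Then the following identities of formal power series in $x$ hold: $$1+f=\frac{F(\frac23,\frac43;\frac32)}{F(\frac23,\frac13;\frac12)},$$ $$(1+f)^2=\frac{F(\frac43,\frac53;\frac52)}{F(\frac43,\frac23;\frac32)},$$ $$(1+f)(1+\tfrac12 f)=\frac{F(\frac53,\frac73;\frac72)}{F(\frac53,\frac43;\frac52)},$$ $$(1+f)(1-\tfrac12 f)=\frac{F(\frac53,\frac73;\frac52)}{F(\frac53,\frac43;\frac32)},$$ $$(1+f)(1+\tfrac25 f)=\frac{F(\frac23,\frac43;\frac52)}{F(\frac23,\frac13;\frac32)},$$ and $$1-\tfrac12 f=\frac{F(\frac13,\frac53;\frac32)}{F(\frac13,\frac23;\frac12)},$$ $$1+\tfrac15 f+\tfrac1{10}f^2=\frac{F(\frac23,\frac73;\frac52)}{F(\frac23,\frac43;\frac32)},$$ $$1+\tfrac67 f+\tfrac27 f^2=\frac{F(\frac43,\frac83;\frac72)}{F(\frac43,\frac53;\frac52)},$$ $$1-\tfrac25 f+\tfrac25 f^2=\frac{F(\frac43,\frac83;\frac52)}{F(\frac43,\frac53;\frac32)},$$ $$1+\tfrac12 f+\tfrac17 f^2=\frac{F(\frac13,\frac53;\frac52)}{F(\frac13,\frac23;\frac32)}.$$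
   Context: The hypergeometric series is the formal power series ${}_2F_1(a,b;c\mid x)=\sum_{n=0}^\infty \frac{(a)_n(b)_n}{n!\,(c)_n}x^n$, where $(u)_n=u(u+1)\cdots(u+n-1)$. (Each right-hand side is an instance of the quotient ${}_2F_1(a,b+1;c+1\mid\cdot)/{}_2F_1(a,b;c\mid\cdot)$ appearing in Gauss's continued fraction.) *)

(* Defs.v *)
From HB Require Import structures.
From mathcomp Require Import all_boot all_order all_algebra.
From mathcomp Require Import boolp.

Set Implicit Arguments.
Unset Strict Implicit.
Unset Printing Implicit Defensive.

Import GRing.Theory.
Local Open Scope ring_scope.

(* Formal power series over R, as coefficient sequences.  The wrapper keeps
   the Cauchy product apart from the pointwise ring structure on functions. *)
Record fps (R : Type) := Fps { fps_coef :> nat -> R }.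

Lemma fpsP (R : Type) (u v : fps R) : u =1 v -> u = v.
Proof. by case: u v => [u] [v] /= /funext ->. Qed.

HB.instance Definition _ (R : Type) := gen_eqMixin (fps R).
HB.instance Definition _ (R : Type) := gen_choiceMixin (fps R).

Section FpsZmodule.
Variable R : zmodType.
Implicit Types u v w : fps R.

Definition fps_zero : fps R := Fps (fun=> 0).
Definition fps_opp u : fps R := Fps (fun n => - u n).
Definition fps_add u v : fps R := Fps (fun n => u n + v n).

Fact fps_addA : associative fps_add.
Proof. by move=> u v w; apply: fpsP => n /=; rewrite addrA. Qed.
Fact fps_addC : commutative fps_add.
Proof. by move=> u v; apply: fpsP => n /=; rewrite addrC. Qed.
Fact fps_add0 : left_id fps_zero fps_add.
Proof. by move=> u; apply: fpsP => n /=; rewrite add0r. Qed.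
Fact fps_addN : left_inverse fps_zero fps_opp fps_add.
Proof. by move=> u; apply: fpsP => n /=; rewrite addNr. Qed.

HB.instance Definition _ :=
  Algebra.isZmodule.Build (fps R) fps_addA fps_addC fps_add0 fps_addN.

Lemma fps_coef0 n : (0 : fps R) n = 0. Proof. by []. Qed.
Lemma fps_coefN u n : (- u) n = - u n. Proof. by []. Qed.
Lemma fps_coefD u v n : (u + v) n = u n + v n. Proof. by []. Qed.

End FpsZmodule.

Section FpsRing.
Variable R : comNzRingType.
Implicit Types u v w : fps R.

Definition fps_one : fps R := Fps (fun n => (n == 0%N)%:R).
Definition fps_mul u v : fps R := Fps (fun n => \sum_(i < n.+1) u i * v (n - i)%N).

Definition fps_trunc m u : {poly R} := \poly_(i < m.+1) u i.

Lemma coef_fps_trunc m u k : (k <= m)%N -> (fps_trunc m u)`_k = u k.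
Proof. by move=> km; rewrite coef_poly ltnS km. Qed.

Lemma fps_mul_trunc m u v k :
  (k <= m)%N -> fps_mul u v k = (fps_trunc m u * fps_trunc m v)`_k.
Proof.
move=> km; rewrite coefM /=; apply: eq_bigr => i _.
rewrite !coef_fps_trunc //; first exact: leq_trans (leq_subr _ _) km.
by apply: leq_trans km; rewrite -ltnS.
Qed.

Fact fps_mulA : associative fps_mul.
Proof.
move=> u v w; apply: fpsP => n.
transitivity (fps_trunc n u * (fps_trunc n v * fps_trunc n w))`_n.
  rewrite coefM; apply: eq_bigr => i _.
  by rewrite coef_fps_trunc -1?ltnS // -fps_mul_trunc // leq_subr.
rewrite mulrA coefM; apply: eq_bigr => i _.
by rewrite -fps_mul_trunc -1?ltnS // coef_fps_trunc // leq_subr.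
Qed.
Fact fps_mulC : commutative fps_mul.
Proof.
by move=> u v; apply: fpsP => n; rewrite !(@fps_mul_trunc n) // mulrC.
Qed.
Fact fps_mul1 : left_id fps_one fps_mul.
Proof.
move=> u; apply: fpsP => n /=; rewrite big_ord_recl /= mul1r subn0.
by rewrite big1 ?addr0 // => i _; rewrite mul0r.
Qed.
Fact fps_mulDl : left_distributive fps_mul +%R.
Proof.
move=> u v w; apply: fpsP => n /=; rewrite -big_split.
by apply: eq_bigr => i _; rewrite mulrDl.
Qed.
Fact fps_one_neq0 : fps_one != 0.
Proof.
by apply/eqP => /(congr1 (fun u : fps R => u 0%N))/eqP; rewrite /= oner_eq0.
Qed.

HB.instance Definition _ := GRing.Zmodule_isComNzRing.Build (fps R)
  fps_mulA fps_mulC fps_mul1 fps_mulDl fps_one_neq0.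

Lemma fps_coef1 n : (1 : fps R) n = (n == 0%N)%:R. Proof. by []. Qed.
Lemma fps_coefM u v n : (u * v) n = \sum_(i < n.+1) u i * v (n - i)%N.
Proof. by []. Qed.

Definition fps_scale (a : R) u : fps R := Fps (fun n => a * u n).

Fact fps_scaleA a b u : fps_scale a (fps_scale b u) = fps_scale (a * b) u.
Proof. by apply: fpsP => n /=; rewrite mulrA. Qed.
Fact fps_scale1 : left_id 1 fps_scale.
Proof. by move=> u; apply: fpsP => n /=; rewrite mul1r. Qed.
Fact fps_scaleDr : right_distributive fps_scale +%R.
Proof. by move=> a u v; apply: fpsP => n /=; rewrite mulrDr. Qed.
Fact fps_scaleDl u : {morph fps_scale^~ u : a b / a + b}.
Proof. by move=> a b; apply: fpsP => n /=; rewrite mulrDl. Qed.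

HB.instance Definition _ := GRing.Zmodule_isLmodule.Build R (fps R)
  fps_scaleA fps_scale1 fps_scaleDr fps_scaleDl.

Fact fps_scaleAl (a : R) u v : a *: (u * v) = (a *: u) * v.
Proof.
apply: fpsP => n /=; rewrite mulr_sumr.
by apply: eq_bigr => i _; rewrite mulrA.
Qed.

HB.instance Definition _ :=
  GRing.Lmodule_isLalgebra.Build R (fps R) fps_scaleAl.
HB.instance Definition _ := GRing.Lalgebra_isComAlgebra.Build R (fps R).

Lemma fps_coefZ (a : R) u n : (a *: u) n = a * u n. Proof. by []. Qed.

(* fps_dilate k u is u(kx). *)
Definition fps_dilate (k : R) u : fps R := Fps (fun n => k ^+ n * u n).

End FpsRing.

Section FpsUnitRing.
Variable R : comUnitRingType.
Implicit Types u v : fps R.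

(* The first n coefficients of the inverse v of u, obtained from
   \sum_(i <= m) u (m - i) * v i = (m == 0). *)
Fixpoint fps_inv_seq u n : seq R :=
  if n is m.+1 then
    let s := fps_inv_seq u m in
    rcons s ((u 0%N)^-1 * ((m == 0%N)%:R - \sum_(i < m) u (m - i)%N * s`_i))
  else [::].

Definition fps_unit : pred (fps R) := fun u => u 0%N \is a GRing.unit.
Definition fps_inv u : fps R :=
  if fps_unit u then Fps (fun n => (fps_inv_seq u n.+1)`_n) else u.

Lemma size_fps_inv_seq u n : size (fps_inv_seq u n) = n.
Proof. by elim: n => //= n IHn; rewrite size_rcons IHn. Qed.

Lemma nth_fps_inv_seq u n i :
  (i < n)%N -> (fps_inv_seq u n)`_i = (fps_inv_seq u i.+1)`_i.
Proof.
elim: n => // n IHn; rewrite ltnS leq_eqVlt => /predU1P[-> // | lt_in].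
by rewrite -IHn //= nth_rcons size_fps_inv_seq lt_in.
Qed.

Fact fps_mulV : {in fps_unit, left_inverse 1 fps_inv *%R}.
Proof.
move=> u Uu; rewrite mulrC; apply: fpsP => n.
rewrite mulrC fps_coefM fps_coef1 big_ord_recr /= subnn /fps_inv.
rewrite (_ : fps_unit u) //= nth_rcons size_fps_inv_seq ltnn eqxx.
rewrite [_ * u 0%N]mulrC mulVKr //.
under eq_bigr => i _ do
  rewrite -/(fps_inv_seq u i.+1) -(nth_fps_inv_seq u (ltn_ord i)) mulrC.
by rewrite addrC subrK.
Qed.
Fact fps_unitP u v : v * u = 1 -> fps_unit u.
Proof.
move=> /(congr1 (fun w : fps R => w 0%N)).
rewrite fps_coefM big_ord1 /= => vu1.
by apply/unitrPr; exists (v 0%N); rewrite mulrC.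
Qed.
Fact fps_inv_out : {in [predC fps_unit], fps_inv =1 id}.
Proof. by move=> u /negbTE Uu; rewrite /fps_inv [fps_unit u]Uu. Qed.

HB.instance Definition _ := GRing.ComNzRing_hasMulInverse.Build (fps R)
  fps_mulV fps_unitP fps_inv_out.

Lemma fps_unitE u : (u \is a GRing.unit) = (u 0%N \is a GRing.unit).
Proof. by []. Qed.

End FpsUnitRing.

Definition pochhammer (R : pzRingType) (u : R) (n : nat) : R :=
  \prod_(i < n) (u + i%:R).

(* In a field x / 0 = 0, so this is the hypergeometric series only when n`!
   and pochhammer c n are nonzero for all n. *)
Definition hyp2F1 (R : fieldType) (a b c : R) : fps R :=
  Fps (fun n => pochhammer a n * pochhammer b n / (n`!%:R * pochhammer c n)).

(* Quotients of hypergeometric series thus never divide by a non-unit, where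
   the inverse of a unitRingType is the identity. *)
Lemma fps_dilate_hyp2F1_unit (R : fieldType) (k a b c : R) :
  fps_dilate k (hyp2F1 a b c) \is a GRing.unit.
Proof.
by rewrite fps_unitE /= /pochhammer !big_ord0 expr0 !mul1r invr1 unitr1.
Qed.

(* Main.v *)
Require Import Defs.
From mathcomp Require Import all_boot all_order all_algebra.
From mathcomp Require Import ring lra.

Set Implicit Arguments.
Unset Strict Implicit.
Unset Printing Implicit Defensive.

Import Order.TTheory GRing.Theory Num.Theory.
Local Open Scope ring_scope.

(** The series [1 + f] is the generating function of ternary trees: [f] is the
    unique power series with [f = x (1 + f)^3].  Hence [x = f / (1 + f)^3], and
    the Euler operator [theta = x d/dx] acts on [f] by
    [theta f = f (1 + f) / (1 - 2 f)].  With [W = 1 / (1 - 2 f)], the algebra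
    generated by [f] and [W] is therefore stable under [theta].

    The thirteen hypergeometric series that occur, up to exchanging [a] and [b],
    are contiguous to [F(2/3, 1/3; 1/2)], the generating function of the numbers
    [C(3n, n)], which equals [(1 + f) W].  All of them lie in the above algebra;
    they have the form [(1 + f)^n (1 + u f + v f^2) W^q] with [q] in 0, 1, 3.
    For instance [F(4/3, 2/3; 3/2)] has the coefficients [C(3n + 1, n)] and
    equals [(1 + f)^2 W].  Each of the denominators has [u = v = 0], and it has
    the same [q] as the numerator above it, so that the quotient is a polynomial
    in [f].  The scale 27/4 puts the singularity of the hypergeometric series at
    [x = 4/27], which is the critical value of [f / (1 + f)^3], taken where
    [1 - 2 f] vanishes.

    The closed forms are verified through the hypergeometric equation
    [theta (theta + c - 1) u = k x (theta + a) (theta + b) u], of which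
    [F(a, b; c | k x)] is the only solution with constant term 1
    ([hyp2F1_ode]).  By [fps_theta_tree_eval], applying [theta] to
    [(1 + f)^n S(f) W^q] amounts to an explicit operation on the polynomial [S];
    once [x] is replaced by [f / (1 + f)^3] the equation becomes an identity
    between one-variable polynomials ([tree_ode], [hyp2F1_tree]), and such an
    identity may be checked at an arbitrary rational number
    ([tree_ode_quadratic]).

    The cubic equation of [f] is itself obtained in this way: the solution [t]
    of [t = x (1 + t)^3] is constructed as a fixed point, the equation identifies
    [1 + t] with [F(2/3, 1/3; 3/2)], and the ratio of consecutive coefficients
    does the same for [1 + f] ([fuss_catalan_eq]). *)

(** * Linear combinations of equations *)

(** Reduces an equation that follows from another one by ideal membership to a
    polynomial identity, once the cofactor [m] is supplied. *)
Lemma eq_by_multiple (A : pzRingType) (m l r x y : A) :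
  l = r -> x - y = m * (l - r) -> x = y.
Proof. by move=> ->; rewrite subrr mulr0 => /subr0_eq. Qed.

Arguments eq_by_multiple {A} m {l r x y}.

(** * Coefficients of power series and fixed points *)

Section Toolkit.
Variable R : comNzRingType.
Implicit Types (u v : fps R) (P : {poly R}).

Definition fpsX : fps R := Fps (fun n => (n == 1%N)%:R).

Lemma coef_fpsX_mul u n : (fpsX * u) n = if n is m.+1 then u m else 0.
Proof.
rewrite fps_coefM; case: n => [|n]; first by rewrite big_ord1 mul0r.
rewrite 2!big_ord_recl /= mul0r add0r mul1r subSS subn0 big1 ?addr0 // => i _.
by rewrite mul0r.
Qed.

Lemma fps_coefM0 u v : (u * v) 0%N = u 0%N * v 0%N.
Proof. by rewrite fps_coefM big_ord1. Qed.

Lemma fps_coefX0 u n : (u ^+ n) 0%N = u 0%N ^+ n.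
Proof. by elim: n => // n IHn; rewrite !exprS fps_coefM0 IHn. Qed.

Definition fps_agree n u v := forall i, (i < n)%N -> u i = v i.

Lemma fps_agreeD n u u' v v' :
  fps_agree n u u' -> fps_agree n v v' -> fps_agree n (u + v) (u' + v').
Proof. by move=> uu' vv' i lt_in; rewrite !fps_coefD uu' ?vv'. Qed.

Lemma fps_agreeM n u u' v v' :
  fps_agree n u u' -> fps_agree n v v' -> fps_agree n (u * v) (u' * v').
Proof.
move=> uu' vv' i lt_in; rewrite !fps_coefM; apply: eq_bigr => j _.
rewrite uu' ?vv' //; first exact: leq_ltn_trans (leq_subr _ _) lt_in.
exact: leq_trans (ltn_ord j) lt_in.
Qed.

Lemma fps_agree_fpsX n u v :
  fps_agree n u v -> fps_agree n.+1 (fpsX * u) (fpsX * v).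
Proof. by move=> uv [|i] lt_in; rewrite !coef_fpsX_mul // uv. Qed.

(** The iterates [T^n 0] and [T^(n+1) 0] agree below [n], so the coefficient of
    [x^n] is settled from the iterate of rank [n + 1] on; the fixed point is the
    resulting diagonal. *)
Lemma fps_fixpoint (T : fps R -> fps R) :
  (forall n u v, fps_agree n u v -> fps_agree n.+1 (T u) (T v)) ->
  exists u, u = T u.
Proof.
move=> contrT; pose s n := iter n T 0.
have sS n : fps_agree n (s n) (s n.+1).
  by elim: n => // n IHn; apply: contrT.
have s_agree n k : fps_agree n (s n) (s (n + k)%N).
  elim: k => [|k IHk] i lt_in; first by rewrite addn0.
  by rewrite IHk // addnS sS // ltn_addr.
exists (Fps (fun n => s n.+1 n)); apply: fpsP => n.
rewrite [LHS]/=; apply: (contrT n) (ltnSn n) => i lt_in /=.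
by rewrite -(subnKC lt_in) -s_agree.
Qed.

Lemma tree_series_exists : exists t : fps R, t = fpsX * (1 + t) ^+ 3.
Proof.
apply: fps_fixpoint => n u v uv; apply: fps_agree_fpsX.
by rewrite !exprS expr0; do !apply: fps_agreeM => //; apply: fps_agreeD.
Qed.

(** * The Euler operator *)

Definition fps_theta u : fps R := Fps (fun n => n%:R * u n).

Lemma fps_thetaD u v : fps_theta (u + v) = fps_theta u + fps_theta v.
Proof. by apply: fpsP => n /=; rewrite mulrDr. Qed.

Lemma fps_thetaN u : fps_theta (- u) = - fps_theta u.
Proof. by apply: fpsP => n /=; rewrite mulrN. Qed.

Lemma fps_theta0 : fps_theta (0 : fps R) = 0.
Proof. by apply: fpsP => n /=; rewrite mulr0. Qed.

Lemma fps_thetaC c : fps_theta c%:A = 0.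
Proof. by apply: fpsP => -[|n] /=; rewrite ?mul0r // !mulr0. Qed.

Lemma fps_theta1 : fps_theta 1 = 0.
Proof. by rewrite -(scale1r 1) fps_thetaC. Qed.

Lemma fps_thetaM u v :
  fps_theta (u * v) = fps_theta u * v + u * fps_theta v.
Proof.
apply: fpsP => n; rewrite fps_coefD !fps_coefM /= mulr_sumr -big_split /=.
apply: eq_bigr => i _; rewrite -{1}(subnKC (ltn_ord i : i <= n)%N) natrD.
by ring.
Qed.

Lemma fps_theta_exp u n :
  fps_theta (u ^+ n) = n%:R * u ^+ n.-1 * fps_theta u.
Proof.
elim: n => [|n IHn]; first by rewrite expr0 fps_theta1 !mul0r.
rewrite exprS fps_thetaM IHn.
case: n {IHn} => [|n] /=; first by rewrite expr0; ring.
by rewrite exprS -!natr1; ring.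
Qed.

Lemma fps_thetaX : fps_theta fpsX = fpsX.
Proof.
by apply: fpsP => -[|[|n]] /=; rewrite ?mul0r ?mulr0 ?mulr1.
Qed.

Lemma horner_algMXaddC u P c :
  horner_alg u (P * 'X + c%:P) = horner_alg u P * u + c%:A.
Proof. by rewrite rmorphD rmorphM /= horner_algX horner_algC. Qed.

Lemma horner_algZ u c P : horner_alg u (c *: P) = c *: horner_alg u P.
Proof. by rewrite -mul_polyC rmorphM /= horner_algC mulr_algl. Qed.

Lemma fps_theta_horner u P :
  fps_theta (horner_alg u P) = horner_alg u P^`() * fps_theta u.
Proof.
elim/poly_ind: P => [|P c IHP].
  by rewrite deriv0 !rmorph0 mul0r fps_theta0.
rewrite derivMXaddC horner_algMXaddC !rmorphD !rmorphM /= horner_algX.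
by rewrite fps_thetaD fps_thetaC fps_thetaM IHP; ring.
Qed.

Lemma coef0_horner_alg u P :
  u 0%N = 0 -> (horner_alg u P) 0%N = P.[0].
Proof.
move=> u0; elim/poly_ind: P => [|P c _]; first by rewrite rmorph0 horner0.
rewrite horner_algMXaddC hornerMXaddC fps_coefD fps_coefM0 u0 !mulr0.
by rewrite fps_coefZ fps_coef1 mulr1.
Qed.

End Toolkit.

(** * The hypergeometric equation *)

Section Hypergeometric.
Variable R : numFieldType.
Implicit Types (u : fps R) (a b c k : R).

Lemma pochhammerS a n : pochhammer a n.+1 = pochhammer a n * (a + n%:R).
Proof. exact: big_ord_recr. Qed.

Lemma hyp2F1_recurrence u k a b c : 0 < c ->
  (forall n, n.+1%:R * (c + n%:R) * u n.+1
             = k * (a + n%:R) * (b + n%:R) * u n) ->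
  u = u 0%N *: fps_dilate k (hyp2F1 a b c).
Proof.
move=> c_gt0 rec_u; have c_neq0 n : c + n%:R != 0.
  by rewrite gt_eqF // ltr_wpDr ?ler0n.
have poch_neq0 n : pochhammer c n != 0.
  by apply/prodf_neq0 => i _; apply: c_neq0.
apply: fpsP; elim=> [|n IHn].
  by rewrite fps_coefZ /= /pochhammer !big_ord0 expr0 !mul1r invr1 mulr1.
have n1_neq0 : n.+1%:R != 0 :> R by rewrite pnatr_eq0.
have fact_neq0 : n`!%:R != 0 :> R by rewrite pnatr_eq0 -lt0n fact_gt0.
apply: (mulfI (mulf_neq0 n1_neq0 (c_neq0 n))); rewrite rec_u IHn !fps_coefZ /=.
rewrite !pochhammerS factS natrM exprS.
move: {IHn} (u 0%N) (poch_neq0 n) (c_neq0 n) n1_neq0 fact_neq0.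
move: (pochhammer c n) (pochhammer a n) (pochhammer b n) (k ^+ n) n`!%:R.
move: (n.+1%:R) (n%:R) => N1 N C A B K F U C0 cN0 N10 F0.
by field; apply/and4P.
Qed.

(** Comparing the coefficients of [x^(n+1)] turns the differential equation
    into the two-term recurrence of the hypergeometric coefficients, because
    [theta] multiplies the coefficient of [x^n] by [n]. *)
Lemma hyp2F1_ode u k a b c : 0 < c ->
  fps_theta (fps_theta u) + (c - 1) *: fps_theta u
    = k *: (fpsX R * (fps_theta (fps_theta u) + (a + b) *: fps_theta u
                      + (a * b) *: u)) ->
  u = u 0%N *: fps_dilate k (hyp2F1 a b c).
Proof.
move=> c_gt0 /(congr1 (@fps_coef R)) ode_u; apply: hyp2F1_recurrence => // n.
have := congr1 (fun s => s n.+1) ode_u.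
rewrite fps_coefD !fps_coefZ coef_fpsX_mul !fps_coefD !fps_coefZ /= -!natr1.
by move=> e; apply: (eq_by_multiple 1 e); ring.
Qed.

End Hypergeometric.

(** * Series parametrized by the solution of t = x (1 + t)^3 *)

(** The operation on [S] that [theta] induces on
    [(1 + t)^n S(t) / (1 - 2 t)^q]; each application raises [q] by 2.  The factor
    [(1 + t)^n] is kept apart because it comes out unchanged, which leaves
    polynomials [S] of degree at most 2 in all the cases needed. *)
Definition tree_theta (R : comNzRingType) (n q : nat) (S : {poly R}) :
    {poly R} :=
  'X * ((1 - 2 *: 'X) * ((1 + 'X) * S^`() + n%:R *: S)
        + (2 * q)%:R *: ((1 + 'X) * S)).

(** The hypergeometric equation for [(1 + t)^n S(t) / (1 - 2 t)^q], with [x]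
    eliminated through [x (1 + t)^3 = t], divided by [(1 + t)^n] and multiplied
    by [(1 - 2 t)^(q + 4)], so that it only involves polynomials in [t]. *)
Definition tree_ode (R : numFieldType) (a b c : R) (n q : nat) (S : {poly R}) :=
  (1 + 'X) ^+ 3 * (tree_theta n q.+2 (tree_theta n q S)
                   + (c - 1) *: ((1 - 2 *: 'X) ^+ 2 * tree_theta n q S))
  = (27 / 4) *: ('X * (tree_theta n q.+2 (tree_theta n q S)
                  + (a + b) *: ((1 - 2 *: 'X) ^+ 2 * tree_theta n q S)
                  + (a * b) *: ((1 - 2 *: 'X) ^+ 4 * S))).

Section TreeSeries.
Variables (R : numFieldType) (t : fps R).
Hypothesis tE : t = fpsX R * (1 + t) ^+ 3.

Let W := (1 - t *+ 2)^-1.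

Lemma tree_coef0 : t 0%N = 0.
Proof. by rewrite tE coef_fpsX_mul. Qed.

Lemma tree_unit_succ : 1 + t \is a GRing.unit.
Proof. by rewrite fps_unitE fps_coefD fps_coef1 tree_coef0 addr0 unitr1. Qed.

Lemma tree_disc_coef0 : (1 - t *+ 2) 0%N = 1.
Proof.
by rewrite mulr2n !(fps_coefD, fps_coefN) fps_coef1 tree_coef0 !addr0 subr0.
Qed.

Lemma tree_disc_unit : 1 - t *+ 2 \is a GRing.unit.
Proof. by rewrite fps_unitE tree_disc_coef0 unitr1. Qed.

Lemma tree_disc_inv : (1 - t *+ 2) * W = 1.
Proof. exact: divrr tree_disc_unit. Qed.

Lemma tree_disc_inv_coef0 : W 0%N = 1.
Proof.
have /(congr1 (@fps_coef R)) e := tree_disc_inv.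
by have := congr1 (fun s => s 0%N) e; rewrite fps_coefM0 tree_disc_coef0 mul1r.
Qed.

Lemma tree_disc_inv_exp n m : W ^+ n = (1 - t *+ 2) ^+ m * W ^+ (n + m).
Proof.
by rewrite addnC exprD mulrA -exprMn tree_disc_inv expr1n mul1r.
Qed.

(** Apply [theta] to [t = x (1 + t)^3]: since [theta x = x], this gives
    [theta t = t + 3 x (1 + t)^2 theta t]; multiplying by [1 + t] and using the
    equation again yields [(1 - 2 t) theta t = t (1 + t)]. *)
Lemma theta_tree : fps_theta t = t * (1 + t) * W.
Proof.
suff e : fps_theta t * (1 - t *+ 2) = t * (1 + t).
  apply: (eq_by_multiple W e).
  by apply: (eq_by_multiple (- fps_theta t) tree_disc_inv); ring.
have : fps_theta t = t + 3 * (fpsX R * (1 + t) ^+ 2 * fps_theta t).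
  rewrite {1}tE fps_thetaM fps_thetaX fps_theta_exp fps_thetaD fps_theta1.
  by rewrite -tE /=; ring.
move=> e; have eX := tE.
apply: (eq_by_multiple (1 + t) e).
apply: (eq_by_multiple (- 3 * fps_theta t) eX); ring.
Qed.

(** Differentiate [(1 - 2 t) W = 1]. *)
Lemma theta_tree_disc_inv : fps_theta W = t * (1 + t) * W ^+ 3 *+ 2.
Proof.
have /(congr1 (@fps_theta R)) := tree_disc_inv.
rewrite fps_thetaM fps_theta1 fps_thetaD fps_thetaN mulr2n fps_thetaD.
rewrite fps_theta1 theta_tree => e.
apply: (eq_by_multiple W e).
apply: (eq_by_multiple (- fps_theta W) tree_disc_inv); ring.
Qed.

(** By the product rule, since [theta t = t (1 + t) W] and
    [theta W = 2 t (1 + t) W^3]; the terms in [W^(q + 1)] are brought to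
    [W^(q + 2)] by the factor [1 - 2 t] in [tree_theta]. *)
Lemma fps_theta_tree_eval S n q :
  fps_theta ((1 + t) ^+ n * horner_alg t S * W ^+ q)
  = (1 + t) ^+ n * horner_alg t (tree_theta n q S) * W ^+ q.+2.
Proof.
rewrite fps_thetaM fps_thetaM fps_theta_horner !fps_theta_exp fps_thetaD.
rewrite fps_theta1 add0r theta_tree theta_tree_disc_inv /tree_theta !scaler_nat.
rewrite !(rmorphM, rmorphD, rmorphN, rmorph1) /= !raddfMn /=.
rewrite !(rmorphM, rmorphD, rmorph1) /= !horner_algX.
have := tree_disc_inv; move: (horner_alg t S^`()) (horner_alg t S).
have -> : n%:R * (1 + t) ^+ n.-1 * (t * (1 + t) * W)
          = n%:R * (1 + t) ^+ n * t * W.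
  by case: n => [|n]; rewrite ?mul0r //= exprS; ring.
move: W (1 + t) ((1 + t) ^+ n) => w g gn A B e.
apply: (eq_by_multiple (- (gn * t * (g * A + n%:R * B) * w ^+ q.+1)) e).
case: q => [|q] /=; rewrite -[_ *+ (2 * _)]mulr_natr natrM; first by ring.
by rewrite !exprS; ring.
Qed.

(** Both sides of the hypergeometric equation carry the factor
    [(1 + t)^n W^(q + 4)], and [tree_ode] evaluated at [t] is what remains. *)
Lemma hyp2F1_tree a b c n q S : 0 < c -> S.[0] = 1 -> tree_ode a b c n q S ->
  fps_dilate (27 / 4) (hyp2F1 a b c)
  = (1 + t) ^+ n * horner_alg t S * W ^+ q.
Proof.
move=> c_gt0 S0 /(congr1 (horner_alg t)).
set ev := horner_alg t; pose H := (1 + t) ^+ n * ev S * W ^+ q => odeS.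
have H0 : H 0%N = 1.
  rewrite /H !fps_coefM0 !fps_coefX0 coef0_horner_alg ?tree_coef0 // S0.
  rewrite fps_coefD fps_coef1 tree_coef0 addr0 expr1n !mul1r.
  by rewrite tree_disc_inv_coef0 expr1n.
rewrite -[RHS]/H [H](@hyp2F1_ode _ _ (27 / 4) a b c) // ?H0 ?scale1r //.
have thH : fps_theta H = (1 + t) ^+ n * ev (tree_theta n q S) * W ^+ q.+2.
  exact: fps_theta_tree_eval.
have ththH : fps_theta (fps_theta H)
    = (1 + t) ^+ n * ev (tree_theta n q.+2 (tree_theta n q S)) * W ^+ q.+4.
  by rewrite thH fps_theta_tree_eval.
rewrite ththH thH /H (tree_disc_inv_exp q 4) (tree_disc_inv_exp q.+2 2).
rewrite addn4 addn2 /= -![_ *: (_ * _)]mulr_algl.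
move: odeS {thH ththH}; move: (tree_theta n q.+2 _) => S2.
move: (tree_theta n q S) => S1.
move: (c - 1) (a + b) (a * b) (27 / 4) => d s p k; rewrite !scaler_nat.
rewrite -!mul_polyC /ev !(rmorphM, rmorphD, rmorphN, rmorphXn, rmorph1) /=.
rewrite !horner_algC !horner_algX => odeS.
(* The series [x] still occurs; it is eliminated by means of [tE]. *)
apply: (mulrI (unitrX 3 tree_unit_succ)).
apply: (eq_by_multiple ((1 + t) ^+ n * W ^+ q.+4) odeS).
have eX := tE.
pose A := horner_alg t S2 + s%:A * ((1 - t *+ 2) ^+ 2 * horner_alg t S1)
          + p%:A * ((1 - t *+ 2) ^+ 4 * horner_alg t S).
apply: (eq_by_multiple (k%:A * A * (1 + t) ^+ n * W ^+ q.+4) eX).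
rewrite /A; move: (W ^+ q.+4) (horner_alg t S2) (horner_alg t S1) => w Q2 Q1.
by move: (horner_alg t S) (k%:A : fps R) ((1 + t) ^+ n) => Q K gn; ring.
Qed.

End TreeSeries.

(** * Checking the polynomial identities *)

(** A nonzero difference would have the infinitely many roots [0, 1, 2, ...]. *)
Lemma poly_eq_horner (R : numDomainType) (P Q : {poly R}) :
  (forall s, P.[s] = Q.[s]) -> P = Q.
Proof.
move=> PQ; apply/eqP; rewrite -subr_eq0; apply/negPn/negP => nz.
pose rs := [seq i%:R : R | i <- iota 0 (size (P - Q))].
have := max_poly_roots nz (rs := rs).
rewrite size_map size_iota ltnn => absurd; apply/notF/absurd.
  by apply/allP => x _; rewrite rootE hornerD hornerN PQ subrr.
by rewrite map_inj_uniq ?iota_uniq // => i j /eqP; rewrite eqr_nat => /eqP.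
Qed.

(** The equation in coordinates, for [S = 1 + u X + v X^2]: at the point [s],
    [h0], [h1] and [h2] are the values of [S], of its image under
    [tree_theta n q] and of the image of the latter under [tree_theta n q.+2]; a
    prime marks the derivative at [s].  For given numbers this is an identity in
    [s] alone. *)
Definition tree_ode_at (R : numFieldType) (a b c : R) (n q : nat) (u v s : R) :=
  let h0 := 1 + u * s + v * s ^+ 2 in
  let h0' := u + 2 * v * s in
  let e := (1 + s) * h0' + n%:R * h0 in
  let e' := 2 * v * (1 + s) + (n%:R + 1) * h0' in
  let r := (1 - 2 * s) * e + (2 * q)%:R * ((1 + s) * h0) in
  let r' := (1 - 2 * s) * e' - 2 * e + (2 * q)%:R * (h0 + (1 + s) * h0') in
  let h1 := s * r in
  let h1' := r + s * r' in
  let h2 := s * ((1 - 2 * s) * ((1 + s) * h1' + n%:R * h1)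
                 + (2 * q.+2)%:R * ((1 + s) * h1)) in
  (1 + s) ^+ 3 * (h2 + (c - 1) * ((1 - 2 * s) ^+ 2 * h1))
  = 27 / 4 * (s * (h2 + (a + b) * ((1 - 2 * s) ^+ 2 * h1)
                   + a * b * ((1 - 2 * s) ^+ 4 * h0))).

Lemma tree_ode_quadratic (R : numFieldType) (a b c : R) n q (u v : R) :
  (forall s, tree_ode_at a b c n q u v s) ->
  tree_ode a b c n q (1 + u *: 'X + v *: 'X ^+ 2).
Proof.
move=> odeS; apply: poly_eq_horner => s; have {odeS} := odeS s.
rewrite /tree_ode_at /= expr2.
rewrite /tree_theta !(derivZ, derivM, derivB, derivD, derivX, derivC).
rewrite !(hornerZ, horner_exp, hornerM, hornerD, hornerN,
          hornerX, horner0, hornerC).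
by move: (27 / 4) => k e; apply: (eq_by_multiple 1 e); ring.
Qed.

Lemma hyp2F1_tree_quadratic (R : numFieldType) (t : fps R) (a b c : R) n q u v :
    t = fpsX R * (1 + t) ^+ 3 ->
    0 < c -> (forall s, tree_ode_at a b c n q u v s) ->
  fps_dilate (27 / 4) (hyp2F1 a b c)
  = (1 + t) ^+ n * (1 + u *: t + v *: t ^+ 2) * (1 - t *+ 2)^-1 ^+ q.
Proof.
move=> tE c_gt0 /tree_ode_quadratic odeS.
rewrite (hyp2F1_tree tE c_gt0 _ odeS); last first.
  rewrite !(hornerD, hornerZ, hornerXn, hornerX, hornerC).
  by rewrite expr0n !mulr0 !addr0.
by rewrite !rmorphD rmorph1 /= !horner_algZ rmorphXn /= !horner_algX.
Qed.

(** The powers of [1 - 2 t] and [(1 + t)^n] cancel from the quotient. *)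
Lemma hyp2F1_tree_quotient (R : numFieldType) (t : fps R) (a b c a' b' c' : R)
    n q m u v :
    t = fpsX R * (1 + t) ^+ 3 -> 0 < c -> 0 < c' ->
    (forall s, tree_ode_at a b c n q 0 0 s) ->
    (forall s, tree_ode_at a' b' c' (m + n) q u v s) ->
  (1 + t) ^+ m * (1 + u *: t + v *: t ^+ 2)
  = fps_dilate (27 / 4) (hyp2F1 a' b' c')
    / fps_dilate (27 / 4) (hyp2F1 a b c).
Proof.
move=> tE c_gt0 c'_gt0 ode_den ode_num.
have unit_den := fps_dilate_hyp2F1_unit (27 / 4) a b c.
apply: (mulIr unit_den); rewrite divrK //.
rewrite (hyp2F1_tree_quadratic tE c_gt0 ode_den).
rewrite (hyp2F1_tree_quadratic tE c'_gt0 ode_num) !scale0r !addr0 mulr1 exprD.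
by rewrite mulrA; congr (_ * _); rewrite mulrAC.
Qed.

(** * The Fuss-Catalan series *)

Definition fuss_catalan : fps rat :=
  Fps (fun n => if n == 0%N then 0
                else 1 / (2 * n + 1)%N%:R * 'C(3 * n, n)%:R).

Lemma bin_triple_fact n :
  'C(3 * n, n)%:R = (3 * n)`!%:R / (n`!%:R * (2 * n)`!%:R) :> rat.
Proof.
have fact_neq0 m : m`!%:R != 0 :> rat by rewrite pnatr_eq0 -lt0n fact_gt0.
apply: (canRL (mulfK (mulf_neq0 (fact_neq0 n) (fact_neq0 (2 * n)%N)))).
by rewrite -!natrM -(@bin_fact (3 * n) n) ?leq_pmull // mulSn addKn.
Qed.

Lemma fuss_catalan_succ_recurrence n :
  n.+1%:R * (3 / 2 + n%:R) * (1 + fuss_catalan) n.+1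
  = 27 / 4 * (2 / 3 + n%:R) * (1 / 3 + n%:R) * (1 + fuss_catalan) n.
Proof.
have coefE m : (1 + fuss_catalan) m = 'C(3 * m, m)%:R / (2 * m + 1)%:R.
  rewrite fps_coefD fps_coef1; case: m => [|m] /=; first by rewrite addr0 divr1.
  by rewrite add0r mul1r mulrC.
rewrite !coefE !bin_triple_fact.
have -> : (2 * n.+1 = (2 * n).+2)%N by rewrite mulnS.
have -> : (3 * n.+1 = (3 * n).+3)%N by rewrite mulnS.
have fact_neq0 m : m`!%:R != 0 :> rat by rewrite pnatr_eq0 -lt0n fact_gt0.
have n_ge0 : 0 <= n%:R :> rat by apply: ler0n.
move: (fact_neq0 n) (fact_neq0 (2 * n)%N) n_ge0.
rewrite !factS !natrM !natrD -!natr1 !natrM.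
move: n`!%:R (2 * n)`!%:R (3 * n)`!%:R n%:R => f1 f2 f3 N f1_neq0 f2_neq0 N_ge0.
by field; do ![apply/andP; split] => //; rewrite gt_eqF //; lra.
Qed.

(** The fixed point [t] satisfies the cubic equation by construction, so it
    suffices that [1 + t] and [1 + fuss_catalan] are the same hypergeometric
    series: the former by the differential equation, the latter by the
    recurrence of its coefficients. *)
Lemma fuss_catalan_eq : fuss_catalan = fpsX rat * (1 + fuss_catalan) ^+ 3.
Proof.
have [t tE] := tree_series_exists rat.
suff -> : fuss_catalan = t by [].
apply: (addrI 1).
have c_gt0 : 0 < 3 / 2 :> rat by lra.
have ode_succ s : tree_ode_at (2 / 3) (1 / 3) (3 / 2 : rat) 1 0 0 0 s.
  by rewrite /tree_ode_at; field.
have := hyp2F1_tree_quadratic tE c_gt0 ode_succ.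
rewrite expr0 expr1 !scale0r !addr0 !mulr1 => <-.
rewrite [LHS](hyp2F1_recurrence _ fuss_catalan_succ_recurrence) //.
by rewrite fps_coefD fps_coef1 addr0 scale1r.
Qed.

(** Rids the left-hand side of trivial powers and zero coefficients, so that it
    reads as in the goal, and verifies the two equations. *)
Ltac verify_quotient :=
  rewrite ?expr0 ?expr1 ?mul1r ?scaleNr ?scale0r ?addr0 ?mulr1; apply;
  [ lra | lra | by rewrite /tree_ode_at => s; field
  | by rewrite /tree_ode_at => s; field ].

Theorem theorem3p1 :
  let f : fps rat :=
    Fps (fun n => if n == 0%N then 0
                  else 1 / (2 * n + 1)%N%:R * 'C(3 * n, n)%:R) in
  let F (a b c : rat) : fps rat := fps_dilate (27 / 4) (hyp2F1 a b c) in
  [/\ 1 + f = F (2/3) (4/3) (3/2) / F (2/3) (1/3) (1/2),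
      (1 + f) ^+ 2 = F (4/3) (5/3) (5/2) / F (4/3) (2/3) (3/2),
      (1 + f) * (1 + (1/2) *: f)
        = F (5/3) (7/3) (7/2) / F (5/3) (4/3) (5/2),
      (1 + f) * (1 - (1/2) *: f)
        = F (5/3) (7/3) (5/2) / F (5/3) (4/3) (3/2) &
      (1 + f) * (1 + (2/5) *: f)
        = F (2/3) (4/3) (5/2) / F (2/3) (1/3) (3/2)]
  /\
  [/\ 1 - (1/2) *: f = F (1/3) (5/3) (3/2) / F (1/3) (2/3) (1/2),
      1 + (1/5) *: f + (1/10) *: f ^+ 2
        = F (2/3) (7/3) (5/2) / F (2/3) (4/3) (3/2),
      1 + (6/7) *: f + (2/7) *: f ^+ 2
        = F (4/3) (8/3) (7/2) / F (4/3) (5/3) (5/2),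
      1 - (2/5) *: f + (2/5) *: f ^+ 2
        = F (4/3) (8/3) (5/2) / F (4/3) (5/3) (3/2) &
      1 + (1/2) *: f + (1/7) *: f ^+ 2
        = F (1/3) (5/3) (5/2) / F (1/3) (2/3) (3/2)].
Proof.
move=> f F; have fE : f = fpsX rat * (1 + f) ^+ 3 by apply: fuss_catalan_eq.
(* [n] and [q] describe the denominator [(1 + f)^n / (1 - 2 f)^q]; [m], [u] and
   [v] describe the quotient [(1 + f)^m (1 + u f + v f^2)]. *)
have quot n q m u v a b c a' b' c' :=
  @hyp2F1_tree_quotient rat f a b c a' b' c' n q m u v fE.
split; split.
- have := quot 1%N 1%N 1%N 0 0; verify_quotient.
- have := quot 2%N 1%N 2%N 0 0; verify_quotient.
- have := quot 4%N 1%N 1%N (1/2) 0; verify_quotient.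
- have := quot 4%N 3%N 1%N (- (1/2)) 0; verify_quotient.
- have := quot 1%N 0%N 1%N (2/5) 0; verify_quotient.
- have := quot 1%N 1%N 0%N (- (1/2)) 0; verify_quotient.
- have := quot 2%N 1%N 0%N (1/5) (1/10); verify_quotient.
- have := quot 4%N 1%N 0%N (6/7) (2/7); verify_quotient.
- have := quot 4%N 3%N 0%N (- (2/5)) (2/5); verify_quotient.
- have := quot 1%N 0%N 0%N (1/2) (1/7); verify_quotient.
Qed.
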